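(* Let $R$ be a ring. If $R$ is a $UU$ ring, a $UJ$ ring, a $2$-$UU$ ring, a $2$-$UJ$ ring, or a $\sqrt{J}U$ ring, then $R$ is a $2$-$\sqrt{J}U$ ring.
   Context: All rings are associative with identity $1\neq 0$. For a ring $R$, $J(R)$ denotes the Jacobson radical, $N(R)$ the set of nilpotent elements, $U(R)$ the group of units, and $\sqrt{J(R)}=\{x\in R : x^m\in J(R)\text{ for some } m\ge 1\}$. The ring $R$ is called: a $UU$ ring if $U(R)=1+N(R)$; a $UJ$ ring if $U(R)=1+J(R)$; a $2$-$UU$ ring if $u^2\in 1+N(R)$ for every $u\in U(R)$; a $2$-$UJ$ ring if $u^2\in 1+J(R)$ for every $u\in U(R)$; a $\sqrt{J}U$ ring if $U(R)=1+\sqrt{J(R)}$; a $2$-$\sqrt{J}U$ ring if $u^2\in 1+\sqrt{J(R)}$ for every $u\in U(R)$. *)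

(* Defs.v *)
(* Mathematical Components, with the classical sets of MathComp-Analysis. *)
From mathcomp Require Import all_boot all_algebra.
From mathcomp Require Import boolp classical_sets.

Set Implicit Arguments.
Unset Strict Implicit.
Unset Printing Implicit Defensive.

Import GRing.Theory.
Local Open Scope classical_set_scope.
Local Open Scope ring_scope.

(* [nzRingType] is the structure of associative, not necessarily commutative
   rings with 1 != 0.  All subsets of a ring are Prop-valued, so that no
   decidability of ideals or of invertibility is assumed. *)

Definition left_ideal (R : nzRingType) (I : set R) : Prop :=
  [/\ I 0,
      forall x y, I x -> I y -> I (x - y) &
      forall a x, I x -> I (a * x)].

Definition maximal_left_ideal (R : nzRingType) (M : set R) : Prop :=
  [/\ left_ideal M,
      M <> setT &
      forall I : set R, left_ideal I -> M `<=` I -> I = M \/ I = setT].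

Definition jacobson (R : nzRingType) : set R :=
  \bigcap_(M in [set M : set R | maximal_left_ideal M]) M.

Arguments jacobson : clear implicits.

Definition sqrt_jacobson (R : nzRingType) : set R :=
  [set x : R | exists2 m : nat, (1 <= m)%N & jacobson R (x ^+ m)].

Definition nilpotents (R : nzRingType) : set R :=
  [set x : R | exists2 n : nat, (1 <= n)%N & x ^+ n = 0].

Definition units (R : nzRingType) : set R :=
  [set u : R | exists v, v * u = 1 /\ u * v = 1].

Arguments sqrt_jacobson : clear implicits.
Arguments nilpotents : clear implicits.
Arguments units : clear implicits.

Lemma units_unitE (R : unitRingType) :
  units R = [set u : R | u \is a GRing.unit].
Proof. by apply/seteqP; split=> u /unitrP. Qed.

Definition one_plus (R : nzRingType) (A : set R) : set R :=
  [set 1 + x | x in A].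

Definition UU_ring (R : nzRingType) : Prop :=
  units R = one_plus (nilpotents R).

Definition UJ_ring (R : nzRingType) : Prop :=
  units R = one_plus (jacobson R).

Definition two_UU_ring (R : nzRingType) : Prop :=
  forall u : R, units R u -> one_plus (nilpotents R) (u ^+ 2).

Definition two_UJ_ring (R : nzRingType) : Prop :=
  forall u : R, units R u -> one_plus (jacobson R) (u ^+ 2).

Definition sqrtJU_ring (R : nzRingType) : Prop :=
  units R = one_plus (sqrt_jacobson R).

Definition two_sqrtJU_ring (R : nzRingType) : Prop :=
  forall u : R, units R u -> one_plus (sqrt_jacobson R) (u ^+ 2).

(* Main.v *)
Require Import Defs.
From mathcomp Require Import all_boot all_algebra.
From mathcomp Require Import classical_sets.

(** The set [sqrt_jacobson R] contains both [jacobson R] (exponent 1) and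
    [nilpotents R] (since 0 lies in the Jacobson radical), so each hypothesis on
    squares of units passes to it by monotonicity of [one_plus].  The hypotheses
    describing all units reduce to this case because the square of a unit is
    again a unit. *)

Import GRing.Theory.
Local Open Scope classical_set_scope.
Local Open Scope ring_scope.

Lemma jacobson0 (R : nzRingType) : jacobson R 0.
Proof. by move=> M [[]]. Qed.

Lemma jacobson_sub_sqrt (R : nzRingType) : jacobson R `<=` sqrt_jacobson R.
Proof. by move=> x Jx; exists 1%N; rewrite ?expr1. Qed.

Lemma nilpotents_sub_sqrt (R : nzRingType) : nilpotents R `<=` sqrt_jacobson R.
Proof. by move=> x [n n_gt0 xn0]; exists n; rewrite ?xn0 //; exact: jacobson0. Qed.

Lemma one_plusS (R : nzRingType) (A B : set R) :
  A `<=` B -> one_plus A `<=` one_plus B.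
Proof. exact: image_subset. Qed.

Lemma units_sqr (R : nzRingType) (u : R) : units R u -> units R (u ^+ 2).
Proof.
move=> [v [vu uv]]; exists (v ^+ 2); rewrite !expr2; split.
- by rewrite mulrA -(mulrA v) vu mulr1 vu.
- by rewrite mulrA -(mulrA u) uv mulr1 uv.
Qed.

Theorem mainTheorem1 (R : nzRingType) :
  UU_ring R \/ UJ_ring R \/ two_UU_ring R \/ two_UJ_ring R \/ sqrtJU_ring R ->
  two_sqrtJU_ring R.
Proof.
have subN := one_plusS _ _ _ (nilpotents_sub_sqrt R).
have subJ := one_plusS _ _ _ (jacobson_sub_sqrt R).
move=> H u Uu; have Uu2 := units_sqr _ _ Uu.
case: H => [UU|[UJ|[UU2|[UJ2|JU]]]].
- by apply: subN; rewrite -UU.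
- by apply: subJ; rewrite -UJ.
- exact/subN/UU2.
- exact/subJ/UJ2.
- by rewrite -JU.
Qed.
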